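(* Let $G$ be an Abelian Polish group, $X$ a separable metrizable space and $f:G\to X$ a universally measurable function. If $f$ is $(G,G)$ shift continuous, then $f$ is continuous (with respect to the Polish topology of $G$).
   Context: A function $f:G\to X$ is $(G,G)$ shift continuous if there exists a second countable topology $\mathcal{T}$ on the set $G$ such that for every $s_0\in G$ the function $G\to X$, $t\mapsto f(s_0+t)$, is $\mathcal{T}$-continuous ($\mathcal{T}$ is not assumed related to the given topology of $G$). A function is universally measurable if it is measurable with respect to the completion of every Borel probability measure on $G$. *)

(* Defs.v *)
From HB Require Import structures.
From mathcomp Require Import all_boot all_order all_algebra.
From mathcomp Require Import all_classical all_reals all_analysis.
From mathcomp Require Import measurable_realfun.

Set Implicit Arguments.
Unset Strict Implicit.
Unset Printing Implicit Defensive.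

Import Order.TTheory GRing.Theory Num.Theory.

Local Open Scope classical_set_scope.
Local Open Scope ring_scope.

(* The library's measurable types are pointed, and a topological abelian group
   is not recognized as pointed by default. *)
#[non_forgetful_inheritance]
HB.instance Definition _ (G : topologicalZmodType) := isPointed.Build G 0.

Definition separable (T : topologicalType) : Prop :=
  exists2 D : set T, countable D & dense D.

(* The metric structure [m] lives on the carrier of [T] and comes with its own
   neighborhoods, which are required to be those of [T]. *)
Definition induces_topology (R : realType) (T : topologicalType)
    (m : Metric R T) : Prop :=
  forall x : T, @nbhs T (Metric.Pack m) x = @nbhs T T x.

Definition metrizable (R : realType) (T : topologicalType) : Prop :=
  exists m : Metric R T, induces_topology m.

(* [cvg F] would require a pointed metric space, hence [exists x, F --> x]. *)
Definition complete_metric (R : realType) (M : metricType R) : Prop :=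
  forall F : set_system M, ProperFilter F -> cauchy F -> exists x : M, F --> x.

Definition completely_metrizable (R : realType) (T : topologicalType) : Prop :=
  exists m : Metric R T, induces_topology m /\ complete_metric (Metric.Pack m).

Definition polish (R : realType) (T : topologicalType) : Prop :=
  separable T /\ completely_metrizable R T.

(* [completed_algebra_gen mu] consists of the sets [A `|` N] with [A] Borel and
   [N] included in a Borel [mu]-null set: it is the domain of the completion
   of [mu]. *)
Definition universally_measurable (R : realType) (T : ptopologicalType)
    (X : topologicalType) (f : T -> X) : Prop :=
  forall (mu : probability (g_sigma_algebraType (@open T)) R) (B : set X),
    <<s @open X >> B -> completed_algebra_gen mu (f @^-1` B).

(* [tau] ranges over all topologies on the carrier of [G], with no separation
   axiom and no relation to a topology that [G] may already have. *)
Definition shift_continuous (G : zmodType) (X : topologicalType)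
    (f : G -> X) : Prop :=
  exists tau : Topological G,
    @second_countable (Topological.Pack tau) /\
    forall s0 : G,
      continuous ((fun t : G => f (s0 + t)) : Topological.Pack tau -> X).

(* Main.v *)
From HB Require Import structures.
Require Import Defs.
From mathcomp Require Import all_boot all_order all_algebra.
From mathcomp Require Import all_classical all_reals all_analysis.
From mathcomp Require Import measurable_realfun zify ring lra.

(* Fix x and a closed neighborhood F of f x, and let W be the set of h with
   f (x + h) in F. If (B_n) is a base of the second countable topology, put
   E_n = {s | f (s + B_n) in F}, C_n = {c | f (E_n + c) in F} and
   A_n = C_n :&: (x - E_n). The A_n cover G, A_n - A_n is included in W, and
   each A_n is a countable intersection of translates and reflections of the
   preimage of F, hence universally measurable. A Steinhaus-type argument of
   Christensen then shows that W is a neighborhood of 0: otherwise pick steps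
   g_k outside W, tending to 0 so fast that h(x) = \sum_k g_k b_k(x) converges,
   where b_k(x) is the k-th binary digit of the real x. Some h^-1(A_n) has
   positive Lebesgue measure in [0, 1], so for k large it contains two reals
   that differ only in their k-th digit, and g_k lies in A_n - A_n. The metric
   of G need not be invariant, which is why the steps are chosen against all the
   finitely many partial sums obtained so far. *)

Set Implicit Arguments.
Unset Strict Implicit.
Unset Printing Implicit Defensive.

Import Order.TTheory GRing.Theory Num.Theory.
Import numFieldNormedType.Exports.

Local Open Scope classical_set_scope.
Local Open Scope ring_scope.

(** * Binary digits *)

Section digits.
Context {R : realType}.
Implicit Types (x : R) (k : nat).

(** The binary digit of weight [2 ^- k.+1], counted from [k = 0]. It makes sense for negative [x] as
    well, since the absolute value keeps the parity. *)
Definition digit k x : bool := odd `|Num.floor (2 ^+ k.+1 * x)|.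

Definition flip k x : R :=
  if digit k x then x - 2 ^- k.+1 else x + 2 ^- k.+1.

Lemma odd_abszD1 (m : int) : odd `|m + 1| = ~~ odd `|m|.
Proof. lia. Qed.

Lemma odd_abszB1 (m : int) : odd `|m - 1| = ~~ odd `|m|.
Proof. lia. Qed.

Lemma digit_flip_diag k x : digit k (flip k x) = ~~ digit k x.
Proof.
rewrite /flip; case: ifPn => dx.
  rewrite /digit mulrBr divff ?expf_neq0// floorDrz ?rpredN ?rpred1//.
  by rewrite floorN ?rpred1// floor1 odd_abszB1 -/(digit k x) dx.
rewrite /digit mulrDr divff ?expf_neq0// floorDrz ?rpred1//.
by rewrite floor1 odd_abszD1 -/(digit k x) dx.
Qed.

Lemma flipK k : involutive (flip k).
Proof.
move=> x; rewrite {1}/flip digit_flip_diag /flip.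
by case: (digit k x); rewrite /= ?subrK ?addrK.
Qed.

Lemma floor_half (x : R) : Num.floor (x / 2) = (Num.floor x %/ 2)%Z.
Proof.
apply: floor_def; have /andP[lo hi] := floor_itv x.
have := divz_eq (Num.floor x) 2.
have : (0 <= Num.floor x %% 2 < 2)%Z by rewrite modz_ge0 ?ltz_pmod.
move: (Num.floor x) (Num.floor x %/ 2)%Z (Num.floor x %% 2)%Z lo hi => m q r.
rewrite intrD => lo hi /andP[r0 r2] mE.
have : (0 : R) <= r%:~R by rewrite ler0z.
have : r%:~R <= (1 : R) by rewrite (ler_int _ r 1); lia.
by move: lo hi; rewrite mE !intrD intrM /= => lo hi r1 r_ge0;
  apply/andP; split; lra.
Qed.

(** The flip moves the floor within a pair [2 q], [2 q + 1], and the digits before the [k]-th one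
    depend on [q] only. *)
Lemma floor_flip_half k x :
  (Num.floor (2 ^+ k.+1 * flip k x) %/ 2)%Z =
  (Num.floor (2 ^+ k.+1 * x) %/ 2)%Z.
Proof.
rewrite /flip; case: ifPn; rewrite /digit => dx.
  rewrite mulrBr divff ?expf_neq0// floorDrz ?rpredN ?rpred1//.
  by rewrite floorN ?rpred1// floor1; move: (Num.floor _) dx => m; lia.
rewrite mulrDr divff ?expf_neq0// floorDrz ?rpred1//.
by rewrite floor1; move: (Num.floor _) dx => m; lia.
Qed.

Lemma digit_flip k j x : j != k -> digit j (flip k x) = digit j x.
Proof.
have low n (y : R) :
    Num.floor (2 ^+ n * y) = (Num.floor (2 ^+ n.+1 * y) %/ 2)%Z.
  by rewrite -floor_half exprSr mulrAC mulfK.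
rewrite neq_ltn => /orP[jk|kj].
  have lowE i : (i <= k)%N ->
      Num.floor (2 ^+ (k - i) * flip k x) = Num.floor (2 ^+ (k - i) * x).
    elim: i => [_|i IH ik]; first by rewrite subn0 low [RHS]low floor_flip_half.
    by rewrite low [RHS]low -subSn// subSS IH// ltnW.
  by rewrite /digit -(subKn jk) lowE// leq_subr.
(* For a later digit, the flip translates the scaled number by an even integer, which keeps the
   parity of the floor. *)
have shift : 2 ^+ j.+1 * 2 ^- k.+1 = (2 * 2 ^+ (j - k.+1))%:~R :> R.
  rewrite -{1}(subnK kj) -addSn exprD mulfK ?expf_neq0//.
  by rewrite exprS rmorphM rmorphXn.
move: (2 ^+ (j - k.+1)) shift => e shift.
rewrite /digit /flip; case: ifPn => _.
  rewrite mulrBr shift floorDrz ?rpredN ?rpred_int//.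
  rewrite -(rmorphN (intr : int -> R)) intrKfloor.
  by move: (Num.floor _) => m; lia.
rewrite mulrDr shift floorDrz ?rpred_int// intrKfloor.
by move: (Num.floor _) => m; lia.
Qed.

End digits.

(** * Digit flips and Lebesgue measure *)

Section flip_measure.
Context {R : realType}.
Local Notation mu := (@lebesgue_measure R).

Lemma measurable_digit k : measurable [set x : R | digit k x].
Proof.
rewrite (_ : [set x | _] = \bigcup_(m in [set m : int | odd `|m|])
    ( *%R (2 ^+ k.+1 : R) @^-1` `[m%:~R, (m + 1)%:~R[%classic)); last first.
  apply/seteqP; split=> [x dx|x [m /= om]].
    by exists (Num.floor (2 ^+ k.+1 * x)) => //=; rewrite in_itv/= floor_itv.
  by rewrite in_itv/= => /floor_def; rewrite /digit => ->.
rewrite bigcup_mkcond; apply: countable_bigcupT_measurable => // m.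
case: ifP => // _; rewrite -[X in measurable X]setTI.
exact: mulrl_measurable.
Qed.

Lemma measurable_fun_digit k : measurable_fun [set: R] (digit k).
Proof.
by apply: (@measurable_fun_bool _ _ _ _ true);
  rewrite setTI; exact: measurable_digit.
Qed.

Lemma measurable_flip k : measurable_fun [set: R] (flip k : R -> R).
Proof.
apply: measurable_fun_ifT; first exact: measurable_fun_digit.
- exact: measurable_funD.
- exact: measurable_funD.
Qed.

Lemma lebesgue_measure_shift (a : R) (A : set R) : measurable A ->
  mu ((fun x => x + a) @^-1` A) = mu A.
Proof.
move=> mA; pose t : R -> measurableTypeR R := fun x => x + a.
have mt : measurable_fun [set: R] t by exact: measurable_funD.
apply/esym/(@lebesgue_measure_unique _ (pushforward mu t)) => //=.
move=> _ [[b c]] _ <-.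
rewrite /pushforward /t.
rewrite (_ : _ @^-1` _ = `](b - a), (c - a)]%classic); last first.
  by apply/seteqP; split=> x /=; rewrite !in_itv/= ltrBlDr lerBrDr.
rewrite !lebesgue_measure_itv/= !lte_fin ltrD2r.
by case: ifP => // _; rewrite -!EFinB; congr EFin; ring.
Qed.

(** The flip exchanges [D] and its complement, and is a translation on each of them. *)
Lemma lebesgue_measure_flip k (A : set R) : measurable A ->
  mu (flip k @^-1` A) = mu A.
Proof.
move=> mA; pose D := [set x : R | digit k x].
have mD : measurable D by exact: measurable_digit.
have mDc : measurable (~` D) by exact: measurableC.
have mf (B : set R) : measurable B -> measurable (flip k @^-1` B).
  by move=> mB; rewrite -[X in measurable X]setTI; exact: measurable_flip.
pose e : R := 2 ^- k.+1.
have fD : flip k @^-1` (A `&` D) = (fun x => x + e) @^-1` (A `&` D).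
  apply/seteqP; split=> x /=.
    rewrite /D/= digit_flip_diag => -[Afx /negbTE dx].
    have fx : flip k x = x + e by rewrite /flip dx.
    by rewrite -fx digit_flip_diag dx.
  move=> [Ax Dx]; have <- : flip k (x + e) = x by rewrite /flip ifT ?addrK.
  by rewrite flipK.
have fDc : flip k @^-1` (A `&` ~` D) = (fun x => x + - e) @^-1` (A `&` ~` D).
  apply/seteqP; split=> x /=.
    rewrite /D/= digit_flip_diag => -[Afx /negP/negPn dx].
    have fx : flip k x = x - e by rewrite /flip dx.
    by rewrite -fx digit_flip_diag dx.
  move=> [Ax Dx]; have <- : flip k (x - e) = x.
    by rewrite /flip ifF -/e ?subrK//; apply/negP.
  by rewrite flipK.
have split (B : set R) : measurable B ->
    mu B = (mu (B `&` D) + mu (B `&` ~` D))%E.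
  move=> mB; rewrite -measureU//; try exact: measurableI.
    by rewrite -setIUr setUv setIT.
  by rewrite setIACA setICr setI0.
rewrite (split A mA) -(lebesgue_measure_shift e (measurableI _ _ mA mD)).
rewrite -(lebesgue_measure_shift (- e) (measurableI _ _ mA mDc)) -fD -fDc.
rewrite addeC -measureU.
- by rewrite -preimage_setU -setIUr setUCl setIT.
- by apply: mf; exact: measurableI.
- by apply: mf; exact: measurableI.
- by rewrite -preimage_setI setIACA setICl setI0 preimage_set0.
Qed.

Lemma dist_flip k x : `|flip k x - x| = (2 ^- k.+1 : R).
Proof.
rewrite /flip; case: ifP => _; rewrite addrAC subrr add0r ?normrN ger0_norm//.
all: by rewrite invr_ge0 exprn_ge0.
Qed.

Lemma flip_meets (A : set R) : measurable A -> (0 < mu A < +oo)%E ->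
  \forall k \near \oo, exists2 x, A x & A (flip k x).
Proof.
move=> mA /andP[A0 Aoo].
have Afin : mu A \is a fin_num by rewrite ge0_fin_numE.
have [r rA] : exists r, mu A = r%:E by exists (fine (mu A)); rewrite fineK.
have r0 : 0 < r by rewrite -lte_fin -rA.
(* The margins [r / 2] here and [r / 4] below are matched by [2 (r - r / 4) = r + r / 2]. *)
have [|U [oU AU UA]] := lebesgue_regularity_outer mA Aoo (_ : 0 < r / 2).
  by rewrite divr_gt0.
have mU : measurable U by exact: open_measurable.
have Ulim : (mu U < (r + r / 2)%:E)%E.
  rewrite -[X in (mu X < _)%E](setDUK AU) measureU//; last 2 first.
  - exact: measurableD.
  - by rewrite setDIK.
  by rewrite /= rA EFinD lteD2lE.
(* Points at distance at least [n.+1%:R^-1] from the complement of [U], which a small flip cannot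
   move out of [U]. As [U] is open, the sets [A]&[V n] increase to [A]. *)
pose V n := [set x : R | forall y, `|y - x| < n.+1%:R^-1 -> U y].
have mV n : measurable (V n).
  apply: closed_measurable; rewrite -openC.
  rewrite (_ : ~` V n = \bigcup_(y in ~` U) ball y n.+1%:R^-1).
    by apply: bigcup_open => y _; exact: ball_open.
  apply/seteqP; split=> [x /existsNP[y /not_implyP[xy Uy]]|x [y /= Uy xy] Vx].
    by exists y.
  exact/Uy/Vx.
have mAV n : measurable (A `&` V n) by exact: measurableI.
have V_le m n : (m <= n)%N -> V m `<=` V n.
  move=> mn x Vx y xy; apply: Vx; apply: (lt_le_trans xy).
  by rewrite lef_pV2 ?posrE// ler_nat ltnS.
have AV : \bigcup_n (A `&` V n) = A.
  apply/seteqP; split=> [x [n _ []]//|x Ax].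
  have /nbhs_ballP[e /= e0 xeU] : nbhs x U.
    by apply: open_nbhs_nbhs; split=> //; exact: AU.
  have [n _ /(_ n (leqnn n)) ne] := near_infty_natSinv_lt (PosNum e0).
  exists n => //; split=> // y xy; apply: xeU; rewrite /ball/= distrC.
  exact: lt_trans ne.
have [n An] : exists n, ((r - r / 4)%:E < mu (A `&` V n))%E.
  apply: contrapT => /forallNP noV.
  have cvgA : mu \o (fun n => A `&` V n) @ \oo --> mu A.
    rewrite -[in X in _ --> X]AV; apply: nondecreasing_cvg_mu.
    - exact: mAV.
    - exact: bigcupT_measurable.
    - by move=> m n mn; apply/subsetPset; apply: setIS; exact: V_le.
  have : (mu A <= (r - r / 4)%:E)%E.
    rewrite -(cvg_lim (@ereal_hausdorff R) cvgA); apply: lime_le.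
      by apply/cvg_ex; exists (mu A).
    by apply: nearW => n /=; rewrite leNgt; apply/negP/noV.
  by rewrite rA lee_fin; lra.
have n0 : 0 < n.+1%:R^-1 :> R by [].
near=> k; apply: contrapT => noA.
pose B := A `&` V n.
have mB : measurable B by exact: mAV.
have mfB : measurable (flip k @^-1` B).
  by rewrite -[X in measurable X]setTI; exact: measurable_flip.
(* B and its flip would be disjoint subsets of U, too large together. *)
have BfB : B `&` flip k @^-1` B = set0.
  rewrite -subset0 => x [[Ax _] [Afx _]]; apply: noA; by exists x.
have BU : B `|` flip k @^-1` B `<=` U.
  move=> x [[/AU//]|[_ Vfx]]; apply: Vfx; rewrite distrC dist_flip.
  apply: (@le_lt_trans _ _ (1 / 2 ^+ k)).
    by rewrite div1r lef_pV2 ?posrE ?exprn_gt0// ler_weXn2l ?ler1n.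
  by near: k; apply: near_infty_natSinv_expn_lt (PosNum n0).
have : (mu (B `|` flip k @^-1` B) <= mu U)%E.
  by apply: le_measure => //; rewrite inE//; exact: measurableU.
rewrite measureU//= lebesgue_measure_flip// leNgt => /negP; apply.
apply: (lt_trans Ulim).
rewrite (_ : r + r / 2 = (r - r / 4) + (r - r / 4)); last lra.
by rewrite EFinD; apply: lteD.
Unshelve. all: by end_near. Qed.
End flip_measure.

(** * Universally measurable sets *)

Section completion.
Context {R : realType}.

(** Take measurable inner approximations [A n] with negligible defect: the defect of the
    intersection lies in the union of the defects. *)
Lemma completed_bigcap d (T : measurableType d) (P : probability T R)
    (S : (set T)^nat) :
  (forall n, completed_algebra_gen P (S n)) ->
  completed_algebra_gen P (\bigcap_n S n).
Proof.
move=> /= cS.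
have /choice[A AP] n : exists A,
    [/\ measurable A, A `<=` S n & P.-negligible (S n `\` A)].
  have [A mA [N negN <-]] := cS n; exists A; split=> //.
  by apply: negligibleS negN => x [[]].
exists (\bigcap_n A n).
  by apply: bigcapT_measurable => n; have [] := AP n.
exists ((\bigcap_n S n) `\` (\bigcap_n A n)).
  have : P.-negligible (\bigcup_n (S n `\` A n)).
    by apply: negligible_bigcup => n; have [] := AP n.
  apply: negligibleS.
  move=> x [Sx /existsNP[n /not_implyP[_ Ax]]]; exists n => //; split=> //.
  exact: Sx.
rewrite setDUK// => x Ax n _; have [_ + _] := AP n; apply; exact: Ax.
Qed.

(** Otherwise every [S n] would be negligible, hence so would the whole space, of probability 1. *)
Lemma completed_cover d (T : measurableType d) (P : probability T R)
    (S : (set T)^nat) :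
  (forall n, completed_algebra_gen P (S n)) -> \bigcup_n S n = setT ->
  exists n A, [/\ measurable A, A `<=` S n & (0 < P A)%E].
Proof.
move=> cS ST; apply: contrapT => noA.
have : P.-negligible [set: T].
  rewrite -ST; apply: negligible_bigcup => n.
  have [A mA [N negN AN]] := cS n; rewrite -AN; apply: negligibleU => //.
  apply/negligibleP => //; apply/eqP; rewrite eq_le measure_ge0 andbT leNgt.
  by apply/negP => PA; apply: noA; exists n, A; split=> //; rewrite -AN; left.
move=> /(measure_negligible measurableT) PT.
by have := @probability_setT _ _ _ P; rewrite PT => /eqP;
  rewrite eq_sym onee_eq0.
Qed.

Definition universally_measurable_set (T : ptopologicalType) (A : set T) :=
  forall mu : probability (g_sigma_algebraType (@open T)) R,
    completed_algebra_gen mu A.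

Definition borel_measurable d (T : measurableType d) (U : topologicalType)
  (h : T -> U) := forall O, open O -> measurable (h @^-1` O).

(** Decompose [A] with respect to the image of [P] under [h], then pull the decomposition back. *)
Lemma completed_preimage d (T : measurableType d) (P : probability T R)
    (U : ptopologicalType) (h : T -> U) (A : set U) :
  borel_measurable h -> universally_measurable_set A ->
  completed_algebra_gen P (h @^-1` A).
Proof.
move=> mh uA.
have mh' : measurable_fun [set: T] (h : T -> g_sigma_algebraType (@open U)).
  apply: (@measurability _ _ T (g_sigma_algebraType (@open U)) setT h
    (@open U)) => //.
  by move=> _ [B oB <-]; rewrite setTI; exact: mh.
have mX (C : set (g_sigma_algebraType (@open U))) :
    measurable C -> measurable (h @^-1` C).
  by move=> mC; rewrite -[X in measurable X]setTI; exact: mh'.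
pose X : {mfun T >-> g_sigma_algebraType (@open U)} :=
  HB.pack (h : T -> g_sigma_algebraType (@open U))
    (@isMeasurableFun.Build _ _ _ _ _ mh').
have [B mB [N [M [mM PM NM]] BN]] := uA (distribution P X).
exists (h @^-1` B); first exact: mX.
exists (h @^-1` N); last by rewrite -preimage_setU BN.
by exists (h @^-1` M); split; [exact: mX|exact: PM|exact: preimage_subset].
Qed.

Lemma universally_measurable_preimage (T U : ptopologicalType)
    (h : T -> U) (A : set U) :
  continuous h -> universally_measurable_set A ->
  universally_measurable_set (h @^-1` A).
Proof.
move=> ch uA mu; apply: completed_preimage => // O oO.
by apply: sub_sigma_algebra; apply: open_comp => // x _; exact: ch.
Qed.

Lemma universally_measurable_bigcap (T : ptopologicalType) (A : (set T)^nat) :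
  (forall n, universally_measurable_set (A n)) ->
  universally_measurable_set (\bigcap_n A n).
Proof. by move=> uA mu; apply: completed_bigcap => n; exact: uA. Qed.

End completion.

(** * Series driven by binary digits *)

Section digit_series.
Context {R : realType}.

Lemma metric_geometric_cvg (M : metricType R) (s : nat -> M) :
  complete_metric M -> (forall k, mdist (s k) (s k.+1) <= 2 ^- k) ->
  exists l : M, s @ \oo --> l.
Proof.
move=> cM sd.
(* The bound is the finite geometric sum of the [2 ^- i] for [N <= i < N + n]. *)
have sdist N n : mdist (s N) (s (N + n)%N) <= 2 * 2 ^- N - 2 * 2 ^- (N + n).
  elim: n => [|n IH]; first by rewrite addn0 mdistxx subrr.
  rewrite addnS; apply: (le_trans (metric_triangle _ (s (N + n)%N) _)).
  apply: (le_trans (lerD IH (sd _))).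
  rewrite [in leRHS]exprS invfM mulrA divff// mul1r.
  by rewrite -addrA lerD2l; lra.
apply: cM; apply/cauchy_ballP => e e0.
have [N _ /(_ N (leqnn N)) Ne] :=
  near_infty_natSinv_expn_lt (PosNum (divr_gt0 e0 (ltr0n R 4))).
have {}Ne : 2 * 2 ^- N < e / 2.
  by move: Ne => /=; rewrite div1r; lra.
have near_sN : \forall n \near \oo, ball (s N) (e / 2) (s n).
  exists N => // n /= Nn; rewrite ballEmdist/= -(subnKC Nn).
  apply: (le_lt_trans (sdist _ _)); apply: le_lt_trans Ne.
  by rewrite gerBl mulr_ge0// invr_ge0 exprn_ge0.
exists (ball (s N) (e / 2), ball (s N) (e / 2)) => //.
by move=> [x y] /= [Nx Ny]; exact: ball_splitr Nx Ny.
Qed.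

(** A limit of points of [O] may leave [O], so [O] is exhausted by the closed sets [V m] of points
    at distance at least [m.+1%:R^-1] from its complement: [h x] is in [O] iff, for some [m],
    [s n x] is eventually in [V m]. *)
Lemma borel_measurable_lim d (T : measurableType d) (M : metricType R)
    (s : nat -> T -> M) (h : T -> M) :
  (forall n, borel_measurable (s n)) -> (forall x, s ^~ x @ \oo --> h x) ->
  borel_measurable h.
Proof.
move=> ms sh O oO.
pose V m := [set y : M | forall z, mdist z y < m.+1%:R^-1 -> O z].
have oV m : open (~` V m).
  rewrite (_ : ~` V m = \bigcup_(z in ~` O) ball z m.+1%:R^-1).
    apply: bigcup_open => z _; rewrite openE => y.
    rewrite ballEmdist/= => zy; apply/nbhs_ballP.
    exists (m.+1%:R^-1 - mdist z y).
      by rewrite /= subr_gt0.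
    move=> w; rewrite !ballEmdist/= ltrBrDl; apply: le_lt_trans.
    exact: metric_triangle.
  apply/seteqP; split=> [y /existsNP[z /not_implyP[zy Oz]]|y [z /= Oz]].
    by exists z => //; rewrite ballEmdist.
  by rewrite ballEmdist/= => zy Vy; exact/Oz/Vy.
have mV n m : measurable (s n @^-1` V m).
  rewrite -[V m]setCK preimage_setC; apply: measurableC.
  exact: (ms n _ (oV m)).
rewrite (_ : h @^-1` O =
  \bigcup_m \bigcup_N \bigcap_n (s (N + n)%N @^-1` V m)).
  apply: bigcupT_measurable => m; apply: bigcupT_measurable => N.
  by apply: bigcapT_measurable => n; exact: mV.
apply/seteqP; split=> [x Ohx|x [m _ [N _ xV]]]; last first.
  have : nbhs (h x) (ball (h x) m.+1%:R^-1).
    by apply: nbhsx_ballx; rewrite invr_gt0.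
  move=> /(sh x)[N' _ sN']; apply: (xV N') => //.
  by have := sN' _ (leq_addl N N'); rewrite /= ballEmdist.
have /nbhs_ballP[e /= e0 hxO] : nbhs (h x) O by exact: open_nbhs_nbhs.
have e20 : 0 < e / 2 by rewrite divr_gt0.
have [m _ /(_ m (leqnn m)) me] := near_infty_natSinv_lt (PosNum e20).
have [N _ sN] := sh x _ (nbhsx_ballx (h x) _ e20).
exists m => //; exists N => // n _ z zs; apply: hxO.
rewrite ballEmdist/= (splitr e).
apply: (le_lt_trans (metric_triangle _ (s (N + n)%N x) _)); apply: ltrD.
  by have := sN _ (leq_addr n N); rewrite /= ballEmdist.
by rewrite metric_sym; exact: lt_trans me.
Qed.

(** The sum depends on finitely many digits, so any [Y] will do. The induction splits on the last
    digit and absorbs [g n] into a translate of [Y]. *)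
Lemma measurable_digit_sum (G : zmodType) (g : nat -> G) n (Y : set G) :
  measurable [set x : R | Y (\sum_(i < n) g i *+ digit i x)].
Proof.
elim: n Y => [|n IH] Y.
  have [Y0|Y0] := pselect (Y 0).
    rewrite [X in measurable X](_ : _ = setT)//.
    by apply/seteqP; split=> x //= _; rewrite big_ord0.
  rewrite [X in measurable X](_ : _ = set0)//.
  by apply/seteqP; split=> x //=; rewrite big_ord0.
rewrite [X in measurable X](_ : _ =
   ([set x | digit n x] `&`
     [set x | [set y | Y (y + g n)] (\sum_(i < n) g i *+ digit i x)]) `|`
   (~` [set x | digit n x] `&` [set x | Y (\sum_(i < n) g i *+ digit i x)])).
  have mD := measurable_digit (R := R) n.
  by apply: measurableU; apply: measurableI => //; exact: measurableC.
apply/seteqP; split=> x /=; rewrite big_ord_recr/=; case: (digit n x).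
- by left.
- by rewrite addr0; right.
- by case=> -[].
- by rewrite addr0 => -[[]|[]].
Qed.

Lemma digit_sum_flip (G : zmodType) (g : nat -> G) k n (x : R) : (k < n)%N ->
  ~~ digit k x ->
  \sum_(i < n) g i *+ digit i (flip k x) = \sum_(i < n) g i *+ digit i x + g k.
Proof.
move=> kn dx; rewrite (bigD1 (Ordinal kn))//= [in RHS](bigD1 (Ordinal kn))//=.
rewrite digit_flip_diag (negbTE dx) mulr0n mulr1n add0r addrC; congr (_ + _).
by apply: eq_bigr => i ik; rewrite digit_flip.
Qed.

End digit_series.

(** * The Steinhaus-type argument in the group *)

Section polish_group.
Context {R : realType} {G : topologicalZmodType}.

Lemma addl_continuous (a : G) : continuous (fun x => a + x).
Proof.
move=> x; apply: (@continuous_comp _ _ _ (fun y => (a, y))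
  (fun z : G * G => z.1 + z.2)).
  by apply: cvg_pair; [exact: cvg_cst|exact: cvg_id].
exact: add_continuous.
Qed.

Lemma addr_continuous (a : G) : continuous (fun x => x + a).
Proof.
have -> : (fun x => x + a) = (fun x => a + x).
  by apply/funext => x; rewrite addrC.
exact: addl_continuous.
Qed.

Variables (m : Metric R G) (mG : induces_topology m).
Local Notation M := (Metric.Pack m).

Lemma exists_small_steps (W : set G) : ~ nbhs 0 W ->
  exists g : nat -> G, (forall k, ~ W (g k)) /\
    forall (b : nat -> bool) k,
      @mdist _ M (\sum_(i < k) g i *+ b i)
        (\sum_(i < k) g i *+ b i + g k) <= 2 ^- k.
Proof.
move=> nW.
have /choice[pick pickP] (kL : nat * seq G) : exists g : G, ~ W g /\
    forall p, p \in kL.2 -> @mdist _ M p (p + g) <= 2 ^- kL.1.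
  case: kL => k L /=.
  (* Finitely many smallness conditions hold together near 0; if [W] contained all their solutions,
     it would be a neighborhood of 0. *)
  have : nbhs (0 : G) [set g |
      forall p, p \in L -> @mdist _ M p (p + g) <= 2 ^- k].
    elim: L => [|p L IH]; first exact: nearW.
    have pN : nbhs (0 : G) [set g | @mdist _ M p (p + g) < 2 ^- k].
      apply: (@addl_continuous p 0 [set y | @mdist _ M p y < 2 ^- k]).
      rewrite addr0 -mG.
      have : nbhs (p : M) (ball (p : M) (2 ^- k)).
        by apply: nbhsx_ballx; rewrite invr_gt0 exprn_gt0.
      by rewrite ballEmdist.
    apply: filterS (filterI pN IH) => g [pg Lg] q;
      rewrite inE => /predU1P[->|/Lg//].
    exact: ltW.
  move=> N0; apply: contrapT => /forallNP nog; apply: nW.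
  apply: filterS N0 => g Ng; apply: contrapT => nWg; exact: (nog g).
(* [L k] lists all the sums that the first [k] steps can form, so the bound for the next step holds
   for every [b]. *)
pose L := fix L k := if k is k'.+1 then
  L k' ++ [seq p + pick (k', L k') | p <- L k'] else [:: 0].
exists (fun k => pick (k, L k)); split=> [k|b k].
  by have [] := pickP (k, L k).
have [_ /=] := pickP (k, L k); apply.
elim: k => [|k IH]; first by rewrite big_ord0 inE.
rewrite big_ord_recr/= mem_cat; case: (b k); last by rewrite addr0 IH.
by rewrite [X in _ || X]map_f ?orbT.
Qed.

Hypothesis cM : complete_metric M.

(** [h] is the pointwise limit of the partial sums. Flipping a zero digit [k] adds [g k] to all sums
    of more than [k] terms, hence to the limit. *)
Lemma exists_digit_series (W : set G) : ~ nbhs 0 W ->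
  exists g : nat -> G, exists h : R -> G,
    [/\ forall k, ~ W (g k), borel_measurable h &
        forall k x, ~~ digit k x -> h (flip k x) = h x + g k].
Proof.
move=> nW; have [g [Wg gd]] := exists_small_steps nW.
pose s (n : nat) (x : R) : M := \sum_(i < n) g i *+ digit i x.
have /choice[h sh] x : exists l : M, s ^~ x @ \oo --> l.
  apply: metric_geometric_cvg => // k; rewrite /s big_ord_recr/=.
  case: (digit k x); first exact: (gd (digit ^~ x)).
  by rewrite addr0 mdistxx invr_ge0 exprn_ge0.
exists g, h; split=> //.
  move=> O oO; apply: (@borel_measurable_lim _ _ _ M s) => //.
    by move=> n Y _; exact: (measurable_digit_sum g n Y).
  rewrite openE => x Ox; rewrite /interior [nbhs _]mG.
  exact: open_nbhs_nbhs.
move=> k x dx.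
have shG y : (s ^~ y : nat -> G) @ \oo --> (h y : G).
  by rewrite -mG; exact: sh.
have shk : (s ^~ (flip k x) : nat -> G) @ \oo --> h x + g k.
  have : ((fun z => z + g k) \o (s ^~ x : nat -> G)) @ \oo --> h x + g k.
    by apply: cvg_comp; [exact: shG|exact: addr_continuous].
  apply: cvg_trans; apply: near_eq_cvg; exists k.+1 => // n /= kn.
  by rewrite /s digit_sum_flip.
have hG : hausdorff_space G.
  move=> p q; have := @metric_hausdorff R M p q.
  by rewrite /cluster /= !mG.
exact: (cvg_unique hG (shG _) shk).
Qed.

Lemma cover_sub_nbhs0 (W : set G) (A : (set G)^nat) :
  (forall n, universally_measurable_set (R := R) (A n)) ->
  \bigcup_n A n = setT ->
  (forall n a b, A n a -> A n (a + b) -> W b) -> nbhs 0 W.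
Proof.
move=> uA AT AW; apply: contrapT => /exists_digit_series[g [h [Wg mh hflip]]].
pose P : probability _ R := uniform_prob (@ltr01 R).
have [|n [B [mB BA PB]]] := completed_cover (P := P)
    (fun n => completed_preimage P mh (uA n)).
  by rewrite -preimage_bigcup AT.
pose C := B `&` `[0, 1].
have mC : measurable C by exact: measurableI.
(* The uniform law lives on [[0, 1]] and is dominated by Lebesgue measure, so a null [C] would give
   [P B = 0]. *)
have C0 : (0 < @lebesgue_measure R C)%E.
  rewrite lt_neqAle measure_ge0 andbT eq_sym; apply/negP => /eqP muC.
  have PBC : P B = P C by exact: integral_uniform_pdf.
  have /null_content_dominatesP/(_ _ mC muC) :=
    dominates_uniform_prob (@ltr01 R).
  by move=> PC; move: PB; rewrite PBC [P C]PC ltxx.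
have Coo : (@lebesgue_measure R C < +oo)%E.
  apply: (@le_lt_trans _ _ (lebesgue_measure `[(0 : R), 1]%classic)).
    by apply: le_measure; rewrite ?inE//; exact: subIsetr.
  by rewrite lebesgue_measure_itv/= lte_fin ltr01 -EFinB ltry.
have [|k _ /(_ k (leqnn k))[x [Bx _] [Bfx _]]] := flip_meets mC.
  by rewrite C0.
(* Starting from the point whose digit is 0 makes the difference [g k] rather than its opposite. *)
have [dx|dx] := boolP (digit k x); last first.
  by apply: (Wg k); apply: (AW n (h x));
    [exact: BA|rewrite -hflip//; exact: BA].
apply: (Wg k); apply: (AW n (h (flip k x))); first exact: BA.
by rewrite -hflip ?flipK ?digit_flip_diag ?dx//; exact: BA.
Qed.

End polish_group.

(** * Shift continuous functions *)

(** This extracts from the second countable topology a single sequence that serves all shifts [s].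
    Indices enumerating no base set get the empty set. *)
Lemma shift_continuous_base (G : zmodType) (X : topologicalType) (f : G -> X) :
  shift_continuous f ->
  exists B : (set G)^nat, forall s c U, open U -> U (f (s + c)) ->
    exists2 n, B n c & forall t, B n t -> U (f (s + t)).
Proof.
move=> [tau [[Bs /countable_injP[num num_inj] [_ bB]] cf]].
pose B n : set G := xget set0 [set V | Bs V /\ num V = n].
exists B => s c U oU Ufsc.
have [V [BV Vc] VU] := bB c _ (cf s c U (open_nbhs_nbhs (conj oU Ufsc))).
have BnumV : B (num V) = V.
  rewrite /B; case: xgetP => [W -> [BW WV]|/(_ V)/not_andP[]//].
  by apply: num_inj; rewrite ?inE.
by exists (num V); rewrite BnumV.
Qed.

Section shift_continuous_measurable.
Context {R : realType} {G : topologicalZmodType} {X : topologicalType}.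
Variable f : G -> X.
Variable B : (set G)^nat.
Hypothesis Bbase : forall s c U, open U -> U (f (s + c)) ->
  exists2 n, B n c & forall t, B n t -> U (f (s + t)).
Hypothesis umeas_f : universally_measurable R f.

(* The intersection reduces to a countable one because the second countable
   topology is hereditarily Lindelof. *)
Lemma universally_measurable_shifts (F : set X) (I : set G) : closed F ->
  universally_measurable_set (R := R)
    [set c : G | forall s, I s -> F (f (s + c))].
Proof.
move=> cF.
have uF : universally_measurable_set (R := R) (f @^-1` F).
  move=> mu; apply: umeas_f; rewrite -[F]setCK -setTD.
  by apply: sigma_algebraCD; apply: sub_sigma_algebra; exact: closed_openC.
(* A single [s] in [I] with [f (s + B n)] off [F] rules out all of [B n], so one condition per [n]
   suffices: by [Bbase], every excluded [c] lies in such a [B n]. *)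
have /choice[S SP] n : exists S : set G,
    [/\ universally_measurable_set (R := R) S,
    [set c | forall s, I s -> F (f (s + c))] `<=` S &
    forall s, I s -> (forall t, B n t -> ~ F (f (s + t))) ->
      S `&` B n `<=` set0].
  have [[s Is Bs]|noS] :=
    pselect (exists2 s, I s & forall t, B n t -> ~ F (f (s + t))).
    exists [set c | F (f (s + c))]; split=> [|c Fc|_ _ _ c [Fc Bc]].
    - exact: (universally_measurable_preimage (@addl_continuous G s) uF).
    - exact: Fc.
    - exact: (Bs c Bc Fc).
  exists setT; split=> // [mu|s Is Bs]; last by case: noS; exists s.
  by exists setT => //; exists set0; [exact: negligible_set0|rewrite setU0].
rewrite (_ : mkset _ = \bigcap_n S n).
  by apply: universally_measurable_bigcap => n; have [] := SP n.
apply/seteqP; split=> [c Fc n _|c Sc s Is].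
  by have [_ + _] := SP n; exact.
apply: contrapT => nF.
have [n Bnc Bn] := Bbase (closed_openC cF) nF.
by have [_ _ /(_ s Is Bn c)] := SP n; apply; split=> //; exact: Sc.
Qed.

End shift_continuous_measurable.

Lemma metrizable_regular (R : realType) (X : topologicalType) :
  metrizable R X -> regular_space X.
Proof.
move=> [m mX] x A; rewrite -mX => /(@uniform_regular (Metric.Pack m) x A)[B].
rewrite mX => xB BA; exists B => // y By; apply: BA => C; rewrite mX; exact: By.
Qed.

Theorem theorem8 (R : realType) (G : topologicalZmodType) (X : topologicalType)
  (f : G -> X) (polishG : polish R G)
  (separableX : separable X) (metrizableX : metrizable R X)
  (umeas_f : universally_measurable R f) (shift_f : shift_continuous f) :
  continuous f.
Proof.
have [_ [m [mG cm]]] := polishG.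
have [B Bbase] := shift_continuous_base shift_f.
move=> x U /(metrizable_regular metrizableX)[V xV VU].
pose F := closure V; have cF : closed F by exact: closed_closure.
pose E n := [set s : G | forall t, B n t -> F (f (t + s))].
pose C n := [set c : G | forall s, E n s -> F (f (s + c))].
(* The shift by [x - c] sends [c] to [x], so some [B n] around [c] is mapped into [F] by
   [t |-> f (x - c + t)]. *)
have cover c : exists n, C n c /\ E n (x - c).
  have [||n Bc Bn] := Bbase (x - c) c V^°; first exact: open_interior.
    by rewrite subrK.
  exists n; split=> [s Es|t /Bn VB]; first by rewrite addrC; exact: Es.
  by rewrite addrC; apply: subset_closure; exact: interior_subset.
have W0 : nbhs (0 : G) [set b | F (f (x + b))].
  apply: (cover_sub_nbhs0 mG cm (A := fun n => C n `&` [set c | E n (x - c)])).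
  (* Both sets come from [universally_measurable_shifts], with [I] equal to [E n] and to [B n];
     [setT] pads the intersection to a sequence. *)
  - move=> n; rewrite -bigcap2E.
    apply: universally_measurable_bigcap => -[|[|i]] /=.
    + exact: (universally_measurable_shifts Bbase umeas_f).
    + apply: (universally_measurable_preimage
          (h := fun c : G => x - c) (A := E n)).
        move=> c; apply: (@continuous_comp _ _ _ -%R (fun d : G => x + d)).
          exact: opp_continuous.
        exact: addl_continuous.
      exact: (universally_measurable_shifts Bbase umeas_f).
    + move=> mu; exists setT => //.
      by exists set0; [exact: negligible_set0|exact: setU0].
  - by rewrite -subTset => c _; have [n] := cover c; exists n.
  (* Membership of [a + b] in [C n] is tested at [x - a], an element of [E n], and
     [x - a + (a + b) = x + b]. *)
  - move=> n a b [_ Ea] [/(_ _ Ea) + _].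
    by rewrite addrA subrK.
have xW : nbhs x ((fun y => - x + y) @^-1` [set b | F (f (x + b))]).
  by apply: (@addl_continuous G (- x) x); rewrite addNr.
by apply: (filterS _ xW) => y; rewrite /= addrA subrr add0r => /VU.
Qed.
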